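(* Let $n\ge2$, let $\frac12<a\le\frac34$ and $b=2a-1$, and let $0<c_0\le1$. If $F$ is the $(a,b)$-set of divergence (a ''set of type I''), then $$\dim_H\big(F\cap[0,c_0]^n\big)\ge\alpha:=\frac12+(n-1)a+b.$$
   Context: For $k\ge k_0$ let $R_k=2^k$, $D_k=R_k^{(n-(n-1)a+nb)/(n+1)}$, $Q_k=R_k^{\frac{n-1}{n+1}(2a-b-1)}$ (here $Q_k=1$). A point $(p_1/q,\dots,p_n/q)$, $p_j,q\in\mathbb{Z}$, is an admissible fraction if $\gcd(p_1,q)=1$ and: $p_2,\dots,p_n$ arbitrary when $q$ is odd; all even when $q\equiv0\pmod4$; all odd when $q\equiv2\pmod4$. Fix $0<c\ll1$. Let $\mathcal{A}_k$ be the collection of axis-parallel boxes (''slabs'') of dimensions $cR_k^{-1/2}\times cR_k^{-1}\times\cdots\times cR_k^{-1}$ (long side in the $x_1$ direction) centered at $\big(2p_1R_k/(qD_k^2),p_2/(D_kq),\dots,p_n/(D_kq)\big)$ with $(p_1/q,\dots,p_n/q)$ admissible and $1\le q\le Q_k$; $F_k=\bigcup_{s\in\mathcal{A}_k}s$, and $F=\limsup_{k\to\infty}F_k=\bigcap_N\bigcup_{k\ge N}F_k$. $\dim_H$ denotes Hausdorff dimension. *)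

(* Defs.v *)
From HB Require Import structures.
From mathcomp Require Import all_boot all_order all_algebra.
From mathcomp Require Import all_classical all_reals all_analysis.

Import Order.TTheory GRing.Theory Num.Theory.
Local Open Scope classical_set_scope.
Local Open Scope ring_scope.

Section Defs.
Variable R : realType.

Definition eucl_dist (n : nat) (x y : 'I_n -> R) : R :=
  Num.sqrt (\sum_(i < n) (x i - y i) ^+ 2).

(** Diameter (in \bar R; -oo for the empty set, +oo if unbounded). *)
Definition diam (n : nat) (A : set ('I_n -> R)) : \bar R :=
  ereal_sup [set (eucl_dist n x y)%:E | x in A & y in A].

Definition hausdorff_delta (n : nat) (s delta : R) (E : set ('I_n -> R)) : \bar R :=
  ereal_inf [set (\sum_(0 <= i <oo) ((fine (diam n (U i))) `^ s)%:E)%E |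
     U in [set U : nat -> set ('I_n -> R) |
        E `<=` \bigcup_i U i /\ forall i, (diam n (U i) <= delta%:E)%E]].

Definition hausdorff_measure (n : nat) (s : R) (E : set ('I_n -> R)) : \bar R :=
  ereal_sup [set hausdorff_delta n s delta E | delta in [set d : R | 0 < d]].

(** Hausdorff dimension: inf { s > 0 | H^s(E) = 0 } (= +oo if empty). *)
Definition hausdorff_dim (n : nat) (E : set ('I_n -> R)) : \bar R :=
  ereal_inf [set s%:E | s in [set s : R | 0 < s /\ hausdorff_measure n s E = 0%E]].

(** Parameters of the construction (coordinate x_1 is the index with value 0). *)
Definition Rk (k : nat) : R := 2 ^+ k.
Definition Dk (n : nat) (a b : R) (k : nat) : R :=
  Rk k `^ ((n%:R - (n%:R - 1) * a + n%:R * b) / (n%:R + 1)).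
Definition Qk (n : nat) (a b : R) (k : nat) : R :=
  Rk k `^ ((n%:R - 1) / (n%:R + 1) * (2 * a - b - 1)).

Definition admissible (n : nat) (p : 'I_n -> int) (q : nat) : Prop :=
  (forall i : 'I_n, val i = 0%N -> coprimez (p i) q%:Z) /\
  (forall i : 'I_n, val i <> 0%N ->
     ((q %% 4 = 0)%N -> (2 %| p i)%Z) /\ ((q %% 4 = 2)%N -> ~~ (2 %| p i)%Z)).

Definition slab_center (n : nat) (a b : R) (k : nat) (p : 'I_n -> int) (q : nat)
  : 'I_n -> R :=
  fun i => if val i == 0%N
           then 2 * (p i)%:~R * Rk k / (q%:R * Dk n a b k ^+ 2)
           else (p i)%:~R / (Dk n a b k * q%:R).

Definition slab (n : nat) (c : R) (k : nat) (ctr : 'I_n -> R) : set ('I_n -> R) :=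
  [set x | forall i : 'I_n,
     `|x i - ctr i| <= (if val i == 0%N then c * (Rk k `^ (- (1/2))) else c / Rk k) / 2].

Definition Fk (n : nat) (a b c : R) (k : nat) : set ('I_n -> R) :=
  [set x | exists (p : 'I_n -> int) (q : nat),
     [/\ admissible n p q, (1 <= q)%N, q%:R <= Qk n a b k &
         slab n c k (slab_center n a b k p q) x]].

Definition Fset (n : nat) (a b c : R) : set ('I_n -> R) :=
  \bigcap_(N in [set: nat]) \bigcup_(k in [set k | (N <= k)%N]) Fk n a b c k.

Definition cube (n : nat) (c0 : R) : set ('I_n -> R) :=
  [set x | forall i, 0 <= x i <= c0].

End Defs.

(* Main.v *)
(* Since b = 2a - 1 we have Q_k = 1 and D_k = R_k^a: only q = 1 occurs, and F_k consists of the
   slabs centred at a full grid of mesh 2 R_k^(-b) in x_1 and R_k^(-a) in the other coordinates.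
   For s < alpha take a sparse sequence k_0 < k_1 < ... and, in each coordinate, the Cantor set
   of points lying at every scale k_j in the intervals cut out by the grid. Sending t in [0,1) to
   the Cantor point with the same address maps [0,1)^n into F, and the image of Lebesgue measure
   gives mass O(r^s) to sets of diameter r: the critical radius is r = 1/R_k, where the mass is
   R_k^(-1 + 1/2 - b) R_k^(-(n-1)a) = r^alpha up to the factors coming from earlier scales, which
   sparseness absorbs. A cover of F with small s-dimensional content would pull back to a
   countable cover of [0,1)^n by boxes of total volume less than 1. *)
Require Import Defs.
From HB Require Import structures.
From mathcomp Require Import all_boot all_order all_algebra.
From mathcomp Require Import all_classical all_reals all_analysis.
From mathcomp Require Import measurable_realfun ring lra zify.
Import Order.TTheory GRing.Theory Num.Theory.
Local Open Scope classical_set_scope.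
Local Open Scope ring_scope.

(** * Covering the unit cube by boxes *)

(** Induction on the dimension by slicing: the mask [A] lets each slice keep the numbering of the
    boxes and drop those it misses. In dimension 0 the empty product makes one selected box count
    1. *)
Lemma box_cover_volume (R : realType) (n : nat) (x g : nat -> 'I_n -> R) (A : pred nat) :
  (forall m i, 0 <= g m i) ->
  (forall t : 'I_n -> R, (forall i, 0 <= t i < 1) ->
     exists2 m, A m & forall i, `|t i - x m i| <= g m i) ->
  (1 <= \sum_(0 <= m <oo) ((A m)%:R * \prod_i (2 * g m i))%:E)%E.
Proof.
elim: n x g A => [|n IH] x g A g0 cov.
  have [|m Am _] := cov (fun=> 0); first by case.
  apply: le_trans (nneseries_lim_ge m.+1 _); last first.
    by move=> *; rewrite lee_fin mulr_ge0// prodr_ge0// => -[].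
  rewrite big_nat_recr//= Am big_ord0 mulr1 leeDr// sume_ge0// => *.
  by rewrite lee_fin mulr_ge0// prodr_ge0// => -[].
pose B m := `[x m ord0 - g m ord0, x m ord0 + g m ord0]%classic : set R.
pose w m := (A m)%:R * \prod_i (2 * g m (lift ord0 i)).
have w0 m : 0 <= w m by rewrite mulr_ge0// prodr_ge0// => i _; rewrite mulr_ge0.
have mI : measurable (`[0, 1[%classic : set R) by exact: measurable_itv.
(* Fix the first coordinate and integrate the covering inequality of the slice over it. *)
have slice u : u \in `[0, 1[ -> (1 <= \sum_(0 <= m <oo) (w m * \1_(B m) u)%:E)%E.
  rewrite in_itv/= => u01.
  apply: le_trans (IH (fun m i => x m (lift ord0 i)) (fun m i => g m (lift ord0 i))
    (fun m => A m && (u \in B m)) _ _) _ => //.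
  - move=> t t01.
    have [|m Am h] := cov (fun i => if unlift ord0 i is Some i' then t i' else u).
      by move=> i; case: unliftP.
    exists m => [|i]; last by have := h (lift ord0 i); rewrite liftK.
    rewrite Am/= inE /B/= in_itv/=; have := h ord0; rewrite unlift_none.
    by rewrite ler_distl.
  - apply: lee_nneseries => [m _ _|m _].
      by rewrite lee_fin mulr_ge0// prodr_ge0// => i _; rewrite mulr_ge0.
    by rewrite lee_fin /w indicE mulrAC -natrM mulnb.
have mB m : measurable (B m) by exact: measurable_itv.
have E1 : (\int[@lebesgue_measure R]_(u in `[0%R, 1%R[) 1 = 1)%E.
  rewrite integral_cst//. 
  by rewrite mul1e; rewrite [LHS]lebesgue_measure_itv/= lte_fin ltr01 oppr0 adde0.
rewrite -{}[X in (X <= _)%E]E1.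
have mf m : measurable_fun (`[0, 1[%classic : set R) (fun u : R => w m * \1_(B m) u).
  apply: measurable_funM => //.
apply: (@le_trans _ _ (\int[@lebesgue_measure R]_(u in `[0%R, 1%R[)
   \sum_(0 <= m <oo) (w m * \1_(B m) u)%:E)%E).
  apply: ge0_le_integral => //.
  apply: ge0_emeasurable_sum => [m u _ _|m _]; first by rewrite lee_fin mulr_ge0.
  by have /measurable_EFinP := mf m.
rewrite integral_nneseries//; first last.
- by move=> m u _; rewrite lee_fin mulr_ge0.
- by move=> m; have /measurable_EFinP := mf m.
apply: lee_nneseries => [m _ _|m _].
  by apply: integral_ge0 => u _; rewrite lee_fin mulr_ge0.
have /= -> := @integralZl_indic _ _ R (@lebesgue_measure R) _ mI (fun=> B m) (w m) _ (mB m);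
  last by move=> /lt_geF; rewrite w0.
rewrite integral_indic//; last exact: mB.
rewrite big_ord_recl mulrCA -/(w m) [in leRHS]mulrC [leRHS]EFinM.
apply: lee_wpmul2l; first by rewrite lee_fin.
apply: (@le_trans _ _ (lebesgue_measure (B m))).
  by apply: le_measure; rewrite ?inE//; [apply: measurableI => //|]; exact: mB.
rewrite lebesgue_measure_itv/= lte_fin; case: ifP => _; last by rewrite lee_fin mulr_ge0.
by rewrite -EFinB lee_fin; lra.
Qed.

(** * Cantor sets along grids *)

Section CantorMap.
(** Intervals of generation j have length [l j]; those of generation j + 1 are centred on multiples
    of [d j]. *)
Variables (R : realType) (d l : nat -> R).
Hypothesis dl : forall j, 0 < l j.+1 <= d j.
Hypothesis ld : forall j, 6 * d j <= l j.

(* Two grid cells are given up so that all children stay inside the parent wherever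
   it sits relative to the grid. *)
Definition children (j : nat) : nat := (Num.truncn (l j / d j) - 2)%N.

Lemma spacing_gt0 j : 0 < d j.
Proof. by have /andP[/lt_le_trans h /h] := dl j. Qed.

(** With T >= 6 the integer part of l/d, the bounds amount to T <= l/d and l/d < T + 1 <= 2 (T -
    2). *)
Lemma children_spec j :
  ((children j)%:R + 2) * d j <= l j /\ l j <= 2 * d j * (children j)%:R.
Proof.
have d0 := spacing_gt0 j; have l6 := ld j.
have q6 : 6 <= l j / d j by rewrite ler_pdivlMr.
have q0 : 0 <= l j / d j by rewrite (le_trans _ q6).
have /andP[h1 h2] := truncn_itv q0.
have t6 : (6 <= Num.truncn (l j / d j))%N by rewrite truncn_ge_nat.
have E : l j = l j / d j * d j by rewrite divfK ?gt_eqF.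
rewrite /children natrB ?(leq_trans _ t6)//.
set T := (Num.truncn _)%:R in h1 *; rewrite -natr1 -/T in h2.
by split; rewrite {1}E; [apply: ler_pM => //|]; nra.
Qed.

Lemma children_gt0 j : (0 < children j)%N.
Proof.
have [_] := children_spec j; case: (children j) => //.
by have := spacing_gt0 j; have := ld j; rewrite mulr0; nra.
Qed.

Fixpoint cells (j : nat) : nat := if j is i.+1 then (cells i * children i)%N else 1%N.

Lemma cells_gt0 j : (0 < cells j)%N.
Proof. by elim: j => //= j IH; rewrite muln_gt0 IH children_gt0. Qed.

(** The [+ 1] leaves room on the left for half a child, whose length is at most [d j]. *)
Definition child_pos (j : nat) (x : R) (m : nat) : int := Num.ceil (x / d j) + 1 + m%:Z.

(** [K] is a mixed-radix address: the quotient by [children i] names the parent, the remainder the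
    place among the siblings. *)
Fixpoint left_end (j K : nat) : R :=
  if j is i.+1 then
    (child_pos i (left_end i (K %/ children i)) (K %% children i))%:~R * d i - l i.+1 / 2
  else 0.

Lemma left_end_nested j K :
  left_end j (K %/ children j) <= left_end j.+1 K /\
  left_end j.+1 K + l j.+1 <= left_end j (K %/ children j) + l j.
Proof.
rewrite /= /child_pos; set x := left_end _ _.
have d0 := spacing_gt0 j; have /andP[l0 l1] := dl j.
have [h _] := children_spec j.
have /andP[c1 c2] := ceil_itv (x / d j).
rewrite intrB ltr_pdivlMr// in c1; rewrite ler_pdivrMr// in c2.
have m0 : 0 <= (K %% children j)%:R :> R by [].
have m1 : (K %% children j)%:R + 1 <= (children j)%:R :> R.
  by rewrite natr1 ler_nat ltn_mod children_gt0.
rewrite !intrD -pmulrn; move: c1 c2 m0 m1 h.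
set c := (Num.ceil _)%:~R; set m := (_ %% _)%:R; set N := (_)%:R => *.
by split; nra.
Qed.

(** Siblings sit at distinct grid points, at least [d j] >= [l j.+1] apart; other pairs inherit the
    separation of their parents. *)
Lemma left_end_sep j K K' : (K < K')%N -> (K' < cells j)%N ->
  left_end j K + l j <= left_end j K'.
Proof.
elim: j K K' => [|j IH] K K' KK' K'c; first by move: K'c KK'; rewrite /= => ? ?; lia.
have N0 := children_gt0 j.
have [eqQ|neQ] := eqVneq (K %/ children j)%N (K' %/ children j)%N.
  rewrite /= -eqQ /child_pos; set c := Num.ceil _.
  have : (K %% children j < K' %% children j)%N.
    by rewrite (divn_eq K (children j)) (divn_eq K' (children j)) eqQ ltn_add2l in KK'.
  rewrite -(ler_nat R) -natr1 !intrD -!pmulrn.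
  have d0 := spacing_gt0 j; have /andP[l0 l1] := dl j.
  set m := (K %% _)%:R; set m' := (K' %% _)%:R => mm; nra.
have QQ : (K %/ children j < K' %/ children j)%N by rewrite ltn_neqAle neQ leq_div2r// ltnW.
have Qc : (K' %/ children j < cells j)%N by rewrite ltn_divLR.
have [_ h1] := left_end_nested j K; have [h2 _] := left_end_nested j K'.
by rewrite (le_trans h1)// (le_trans (IH _ _ QQ Qc)).
Qed.

(** All intervals of a generation, siblings or not, are centred on one global grid, so consecutive
    ones are at least a full mesh apart. *)
Lemma left_end_step j K K' : (K <= K')%N -> (K' < cells j.+1)%N ->
  (K'%:R - K%:R) * d j <= left_end j.+1 K' - left_end j.+1 K.
Proof.
elim: K' => [|K' IH]; first by rewrite leqn0 => /eqP-> _; rewrite !subrr mul0r.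
rewrite leq_eqVlt => /predU1P[-> _|]; first by rewrite !subrr mul0r.
rewrite ltnS => KK' K'c; have := IH KK' (ltnW K'c).
have := left_end_sep j.+1 _ _ (ltnSn K') K'c.
have d0 := spacing_gt0 j; have /andP[l0 l1] := dl j.
rewrite /=; set z' := child_pos _ _ (_.+1 %% _); set z := child_pos _ _ (K' %% _).
set x := (child_pos _ _ (K %% _))%:~R => h1 h2.
have : z%:~R < z'%:~R :> R by rewrite -(ltr_pM2r d0); lra.
rewrite ltr_int -lezD1 -(ler_int R) intrD -natr1 => h3.
nra.
Qed.

(* The cell of generation [j] containing [t] once [0, 1) is cut into [cells j] equal parts:
   [cantor_point] transports Lebesgue measure to the uniform measure on the Cantor set. *)
Definition cell (j : nat) (t : R) : nat := Num.truncn (t * (cells j)%:R).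

Lemma cell_div j t : 0 <= t -> (cell j.+1 t %/ children j)%N = cell j t.
Proof.
move=> t0; rewrite /cell.
have N0 := children_gt0 j; have N0' : 0 < (children j)%:R :> R by rewrite ltr0n.
have h0 i : 0 <= t * (cells i)%:R by rewrite mulr_ge0.
have /andP[h1 h2] := truncn_itv (h0 j).
apply/eqP; rewrite eqn_leq; apply/andP; split.
  rewrite -ltnS ltn_divLR// truncn_lt_nat// natrM/= natrM mulrA.
  by rewrite ltr_pM2r.
by rewrite leq_divRL// truncn_ge_nat// natrM/= natrM mulrA ler_pM2r.
Qed.

Lemma cell_lt j t : 0 <= t < 1 -> (cell j t < cells j)%N.
Proof.
move=> /andP[t0 t1]; rewrite truncn_lt_nat ?mulr_ge0//.
by rewrite gtr_pMl// ltr0n cells_gt0.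
Qed.

Definition cantor_point (t : R) : R := sup [set left_end j (cell j t) | j in [set: nat]].

Lemma cantor_point_cell j t : 0 <= t ->
  left_end j (cell j t) <= cantor_point t <= left_end j (cell j t) + l j.
Proof.
move=> t0.
have up i m : left_end i (cell i t) <= left_end (i + m) (cell (i + m) t) /\
    left_end (i + m) (cell (i + m) t) + l (i + m)%N <= left_end i (cell i t) + l i.
  elim: m => [|m [IH1 IH2]]; first by rewrite addn0.
  rewrite addnS; have [] := left_end_nested (i + m) (cell (i + m).+1 t).
  by rewrite cell_div// => h1 h2; split; lra.
have l0 i : 0 <= l i by have := spacing_gt0 i; have := ld i; lra.
(* By nesting, each left end lies below each right end, whichever generation is the older. *)
have ub i m : left_end i (cell i t) <= left_end m (cell m t) + l m.
  have [im|/ltnW mi] := leqP i m.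
    by have [+ _] := up i (m - i)%N; rewrite subnKC// => /le_trans; apply; rewrite lerDl.
  have [_] := up m (i - m)%N; rewrite subnKC//; apply: le_trans; by rewrite lerDl.
apply/andP; split.
  apply: ub_le_sup; last by exists j.
  by exists (left_end 0 (cell 0 t) + l 0%N) => _ [i _ <-]; exact: ub.
apply: ge_sup; first by exists (left_end 0 (cell 0 t)), 0%N.
by move=> _ [i _ <-]; exact: ub.
Qed.

Lemma cantor_point_itv t : 0 <= t -> 0 <= cantor_point t <= l 0%N.
Proof. by move=> t0; have := cantor_point_cell 0 _ t0; rewrite /= add0r. Qed.

(** This places the point in a slab of scale [k j], coordinate by coordinate, once [l j.+1] is the
    side of the slab. *)
Lemma cantor_point_near j t : 0 <= t ->
  exists p : int, `|cantor_point t - p%:~R * d j| <= l j.+1 / 2.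
Proof.
move=> t0; have := cantor_point_cell j.+1 _ t0; rewrite /=.
set p := child_pos _ _ _ => h; exists p; rewrite ler_norml; lra.
Qed.

(* An upper bound for 1 / (number of intervals * their length), see [density_cells]. *)
Fixpoint density (j : nat) : R :=
  if j is i.+1 then 2 * d i / l i.+1 * density i else (l 0%N)^-1.

(** One generation multiplies the total length by N [l j.+1] / [l j], with N = [children j], and N /
    [l j] >= 1 / (2 [d j]) by [children_spec]. *)
Lemma density_cells j : ((cells j)%:R * l j)^-1 <= density j.
Proof.
elim: j => [|j IH]; first by rewrite /= mul1r.
have d0 := spacing_gt0 j; have /andP[l0 l1] := dl j; have l6 := ld j.
have [_ h] := children_spec j.
have lj : 0 < l j by lra.
have N0 : 0 < (children j)%:R :> R by rewrite ltr0n children_gt0.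
have c0 : 0 < (cells j)%:R :> R by rewrite ltr0n cells_gt0.
rewrite /= natrM; apply: le_trans (ler_wpM2l _ IH); last first.
  by rewrite divr_ge0 ?mulr_ge0 ?ltW.
rewrite -[leRHS]invrK lef_pV2 ?posrE ?invr_gt0 ?mulr_gt0 ?invr_gt0 ?mulr_gt0//.
have -> : (2 * d j / l j.+1 * ((cells j)%:R * l j)^-1)^-1 =
   (cells j)%:R * l j.+1 * (l j / (2 * d j)) by field; rewrite !gt_eqF.
rewrite -!mulrA ler_pM2l// mulrC ler_pM2r//.
by rewrite ler_pdivrMr ?mulr_gt0// mulrC.
Qed.

Lemma density_ge0 j : 0 <= density j.
Proof.
apply: le_trans (density_cells j); rewrite invr_ge0 mulr_ge0//.
by have := spacing_gt0 j; have := ld j; lra.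
Qed.

(** If K <= K' are the cells of generation j + 1 among c, then t' - t <= (K' - K + 1) / c. By
    [left_end_step], (K' - K) [d j] is at most the distance of the images plus one interval length;
    the term 2 [d j] pays for that length and for the extra 1. *)
Lemma cantor_point_dist j t t' : 0 <= t < 1 -> 0 <= t' < 1 ->
  `|t - t'| <= 2 * density j * (`|cantor_point t - cantor_point t'| + 2 * d j).
Proof.
wlog tt' : t t' / t <= t' => [W ht ht'|ht ht'].
  by have [/W|/ltW/W] := leP t t'; [exact|rewrite distrC [`|cantor_point t - _|]distrC; exact].
have /andP[t0 t1] := ht; have /andP[t'0 t'1] := ht'.
have h1 := cantor_point_cell j.+1 _ t0; have h2 := cantor_point_cell j.+1 _ t'0.
have KK' : (cell j.+1 t <= cell j.+1 t')%N by rewrite le_truncn// ler_wpM2r.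
have h3 := left_end_step j _ _ KK' (cell_lt _ _ ht').
have d0 := spacing_gt0 j; have /andP[l0 l1] := dl j; have l6 := ld j.
set c := (cells j.+1)%:R : R.
have c0 : 0 < c by rewrite ltr0n cells_gt0.
have [/andP[p1 p2] /andP[p3 p4]] : (cell j.+1 t)%:R <= t * c < (cell j.+1 t).+1%:R /\
   (cell j.+1 t')%:R <= t' * c < (cell j.+1 t').+1%:R.
  by split; apply: truncn_itv; rewrite mulr_ge0// ltW.
rewrite -natr1 in p2; rewrite -natr1 in p4.
set D := `|cantor_point t - _|.
have hD : cantor_point t' - cantor_point t <= D by rewrite /D distrC ler_norm.
have k1 : (t' - t) * c * d j <= D + 2 * d j.
  apply: (@le_trans _ _ (((cell j.+1 t')%:R - (cell j.+1 t)%:R + 1) * d j)).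
    by rewrite ler_pM2r//; lra.
  by rewrite mulrDl mul1r; lra.
have k2 : (c * d j)^-1 <= 2 * density j.
  have [_ N2] := children_spec j.
  have := density_cells j.
  have cj : 0 < (cells j)%:R :> R by rewrite ltr0n cells_gt0.
  move=> dc; rewrite -[leLHS]mul1r.
  apply: le_trans (ler_wpM2l _ dc) => //.
  rewrite mul1r -[leRHS]invrK lef_pV2 ?posrE ?invr_gt0 ?mulr_gt0 ?invr_gt0 ?mulr_gt0//; try lra.
  have -> : (2 * ((cells j)%:R * l j)^-1)^-1 = (cells j)%:R * l j / 2.
    by field; rewrite !gt_eqF//; lra.
  by rewrite /c /= natrM; have := ler_wpM2l (ltW cj) N2; lra.
rewrite distrC ger0_norm ?subr_ge0//.
have E : t' - t = ((t' - t) * c * d j) * (c * d j)^-1.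
  by rewrite -(mulrA _ c) mulfK// gt_eqF ?mulr_gt0.
have D0 : 0 <= D := normr_ge0 _.
have cd0 : 0 < c * d j by rewrite mulr_gt0.
rewrite E mulrC; apply: ler_pM => //; first by rewrite ltW// invr_gt0.
by rewrite -mulrA mulr_ge0 ?subr_ge0// ltW.
Qed.

End CantorMap.

(** * The mass distribution principle *)

(** A point of [U] rules out diameter -oo and the bound [d] rules out +oo, so [fine] returns the
    true diameter. *)
Lemma coord_le_diam (R : realType) (n : nat) (U : set ('I_n -> R)) (d : R) (x y : 'I_n -> R) :
  (diam R n U <= d%:E)%E -> U x -> U y ->
  [/\ 0 <= fine (diam R n U), fine (diam R n U) <= d &
      forall i, `|x i - y i| <= fine (diam R n U)].
Proof.
move=> Ud Ux Uy.
have le u v : U u -> U v -> ((eucl_dist R n u v)%:E <= diam R n U)%E.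
  by move=> Uu Uv; apply: ereal_sup_ubound; exists u => //; exists v.
have fin : diam R n U \is a fin_num.
  rewrite fin_numE; apply/andP; split.
    by have := le x y Ux Uy; case: diam.
  by move: Ud; case: diam.
have le' u v : U u -> U v -> eucl_dist R n u v <= fine (diam R n U).
  by move=> Uu Uv; rewrite -lee_fin fineK// le.
split.
- by apply: le_trans (le' x y Ux Uy); exact: sqrtr_ge0.
- by rewrite -lee_fin fineK.
- move=> i; apply: le_trans (le' x y Ux Uy).
  rewrite -sqrtr_sqr; apply: ler_wsqrtr.
  by rewrite (bigD1 i)//= lerDl sumr_ge0// => j _; exact: sqr_ge0.
Qed.

(* Mass distribution principle for the image of Lebesgue measure under [f]. *)
Lemma hausdorff_dim_ge (R : realType) (n : nat) (E : set ('I_n -> R)) (alpha : R) :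
  (forall s, 0 < s -> s < alpha ->
    exists (f : ('I_n -> R) -> 'I_n -> R) (C r0 : R),
    [/\ 0 < r0, forall t, (forall i, 0 <= t i < 1) -> E (f t) &
      forall r, 0 < r < r0 -> exists g : 'I_n -> R,
      [/\ forall i, 0 <= g i, \prod_i g i <= C * r `^ s &
        forall t t', (forall i, 0 <= t i < 1) -> (forall i, 0 <= t' i < 1) ->
        (forall i, `|f t i - f t' i| <= r) -> forall i, `|t i - t' i| <= g i]]) ->
  (alpha%:E <= hausdorff_dim R n E)%E.
Proof.
move=> H; apply: le_ereal_inf_tmp => _ [s [s0 Hs] <-]; rewrite lee_fin leNgt.
apply/negP => /(H _ s0) [f [C [r0 [r00 fE hr]]]].
(* The boxes have sides 2 g, hence 2^n. The cover and the correction [eps] each contribute at most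
   eta, and 2 M eta < 1. *)
pose M := 2 ^+ n * `|C|; have M0 : 0 <= M by rewrite mulr_ge0// exprn_ge0.
pose eta := (4 * (M + 1))^-1.
have eta0 : 0 < eta by rewrite invr_gt0; lra.
have : (hausdorff_delta R n s (r0 / 2) E < eta%:E)%E.
  apply: (@le_lt_trans _ _ 0%E); last by rewrite lte_fin.
  by rewrite -Hs; apply: ereal_sup_ubound; exists (r0 / 2) => //=; rewrite divr_gt0.
move=> /ereal_inf_lt [_ [U [EU Ud] <-] Useries].
(* Sets of diameter 0 are charged a small positive radius. *)
pose eps m : R := Num.min (r0 / 2) ((eta / (2 ^ m.+1)%:R) `^ s^-1).
have em0 m : 0 < eta / (2 ^ m.+1)%:R by rewrite divr_gt0// ltr0n expn_gt0.
have eps0 m : 0 < eps m by rewrite /eps lt_min powR_gt0 ?em0// divr_gt0.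
(* Only sets that meet the image of the cube give a box; it is centred at a chosen preimage
   [t0 m]. *)
pose A m := `[< exists2 t, (forall i, 0 <= t i < 1) & U m (f t) >].
pose r m := Num.max (fine (diam R n (U m))) (eps m).
have rpos m : 0 < r m by rewrite lt_max eps0 orbT.
have rs m : r m `^ s <= fine (diam R n (U m)) `^ s + eta / (2 ^ m.+1)%:R.
  rewrite /r; have [_|_] := leP (fine _) (eps m); last by rewrite lerDl ltW.
  apply: (@le_trans _ _ (eta / (2 ^ m.+1)%:R)); last by rewrite lerDr powR_ge0.
  have -> : eta / (2 ^ m.+1)%:R = ((eta / (2 ^ m.+1)%:R) `^ s^-1) `^ s.
    by rewrite -powRrM mulVf ?gt_eqF// powRr1// ltW.
  apply: ge0_ler_powR; rewrite ?nnegrE ?powR_ge0 ?(ltW s0) ?(ltW (eps0 m))//.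
  by rewrite /eps ge_min lexx orbT.
have /choice[t0 t0P] (m : nat) : exists t0 : 'I_n -> R,
    (exists2 t, (forall i, 0 <= t i < 1) & U m (f t)) ->
    (forall i, 0 <= t0 i < 1) /\ U m (f t0).
  have [[t t01 Ut]|no] := pselect (exists2 t, (forall i, 0 <= t i < 1) & U m (f t)).
    by exists t.
  by exists (fun=> 0) => /no.
have /choice[g gP] (m : nat) : exists g : 'I_n -> R,
    [/\ forall i, 0 <= g i, A m -> \prod_i g i <= `|C| * r m `^ s &
      forall t, (forall i, 0 <= t i < 1) -> U m (f t) -> forall i, `|t i - t0 m i| <= g i].
  have [[t1 t101 Ut1]|no] := pselect (exists2 t, (forall i, 0 <= t i < 1) & U m (f t)); last first.
    by exists (fun=> 0); split => // [/asboolP//|t t01 Ut]; case: no; exists t.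
  have [t001 Ut0] := t0P m (ex_intro2 _ _ t1 t101 Ut1).
  have [d0 d1 _] := coord_le_diam _ _ _ _ _ _ (Ud m) Ut0 Ut0.
  have rr0 : 0 < r m < r0.
    by rewrite rpos/= gt_max (le_lt_trans d1)/= ?gt_min; lra.
  have [g [g0 gC gf]] := hr _ rr0; exists g; split => // [_|].
    by apply: le_trans gC _; rewrite ler_wpM2r ?powR_ge0 ?ler_norm.
  move=> t t01 Ut; apply: gf => // i.
  have [_ _ /(_ i)] := coord_le_diam _ _ _ _ _ _ (Ud m) Ut Ut0.
  by move=> /le_trans; apply; rewrite le_max lexx.
have := box_cover_volume _ _ t0 g A.
rewrite leNgt => /(_ _ _)/negP; apply.
- by move=> m i; have [] := gP m.
- move=> t t01; have [m _ Um] := EU _ (fE t t01); exists m => [|i].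
    by apply/asboolP; exists t.
  by have [_ _] := gP m; apply.
apply: (@le_lt_trans _ _ (\sum_(0 <= m <oo) M%:E *
   ((fine (diam R n (U m)) `^ s)%:E + (eta / (2 ^ m.+1)%:R)%:E))%E).
  apply: lee_nneseries => [m _ _|m _].
    rewrite lee_fin mulr_ge0// prodr_ge0// => i _.
    by rewrite mulr_ge0//; have [] := gP m.
  have b0 : 0 <= fine (diam R n (U m)) `^ s + eta / (2 ^ m.+1)%:R.
    by rewrite addr_ge0 ?powR_ge0// ltW.
  rewrite lee_fin/=; case: (boolP (A m)) => [Am|_]; last by rewrite mul0r mulr_ge0.
  rewrite mul1r big_split/= prodr_const card_ord /M -mulrA.
  apply: ler_wpM2l; first exact: exprn_ge0.
  have [_ /(_ Am) h _] := gP m; apply: le_trans h _.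
  by apply: ler_wpM2l => //; exact: rs.
rewrite nneseriesZl; last first.
  by move=> m _; rewrite lee_fin addr_ge0 ?powR_ge0// ltW.
apply: (@le_lt_trans _ _ (M%:E * (eta + eta)%:E)%E).
  apply: lee_wpmul2l; first by rewrite lee_fin.
  apply: le_trans (epsilon_trick xpredT _ (ltW eta0)) _.
    by move=> m; rewrite lee_fin powR_ge0.
  by rewrite EFinD leeD2r// ltW.
rewrite -EFinM lte_fin /eta.
have E4 : 4 * (M + 1) * (4 * (M + 1))^-1 = 1 by rewrite mulfV// gt_eqF//; lra.
rewrite -/eta in E4 *; nra.
Qed.

(** * Estimates between consecutive scales *)

(** Writing r = Q^(-t) turns inequalities between powers into inequalities between exponents. *)
Lemma powR_surj (R : realType) (Q r : R) : 1 < Q -> 0 < r -> exists t, r = Q `^ (- t).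
Proof.
move=> Q1 r0; have Q0 : 0 < Q by lra.
have lQ : 0 < ln Q by rewrite ln_gt0.
exists (- (ln r / ln Q)); rewrite opprK /powR gt_eqF//.
by rewrite divfK ?gt_eqF// lnK.
Qed.

Lemma powR_le_mono (R : realType) (Q x y : R) : 1 < Q -> (Q `^ x <= Q `^ y) = (x <= y).
Proof.
move=> Q1; have Q0 : 0 < Q by lra.
by rewrite /powR gt_eqF// ler_expR ler_pM2r// ln_gt0.
Qed.

Lemma powR_exprn (R : realType) (Q x : R) (m : nat) : (Q `^ x) ^+ m = Q `^ (m%:R * x).
Proof. by rewrite -powR_mulrn ?powR_ge0// -powRrM mulrC. Qed.

(** With r = Q^(-t) the claim is t (al - m) <= b. As a < 1, al - m is largest for m = 1, where it is
    a + b - 1/2 = 3b/2, and t <= 1/2. *)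
Lemma long_scale_bound (R : realType) (m : nat) (a b al Q r : R) :
  (0 < m)%N -> 1/2 < a -> a <= 3/4 -> b = 2 * a - 1 -> al = 1/2 + m%:R * a + b ->
  1 < Q -> Q `^ (- (1/2)) <= r -> 0 < r -> r <= Q `^ (- b) ->
  Q `^ (- b) * r ^+ m <= r `^ al.
Proof.
move=> m0 a1 a2 bE aE Q1 r1 r0 r2; have Q0 : 0 < Q by lra.
have [t rt] := powR_surj _ _ _ Q1 r0; subst r.
rewrite !powR_le_mono// !lerN2 in r1 r2.
rewrite powR_exprn -powRD; last by rewrite (gt_eqF Q0)/= implybT.
rewrite -powRrM powR_le_mono//.
have m1 : 1 <= m%:R :> R by rewrite ler1n.
have h : al - m%:R <= a + b - 1/2 by rewrite aE; nra.
have : t * (al - m%:R) <= t * (a + b - 1/2) by rewrite ler_pM2l//; lra.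
nra.
Qed.

(** Let r = Q^(-t), 1/2 <= t <= 1. If t <= a the worst case is m = 1, t = 1/2, where a >= 1/2
    suffices. If t >= a the claim is t (al - 1) <= al - 1, with equality at the critical radius r =
    1/Q. *)
Lemma short_scale_bound (R : realType) (m : nat) (a b al Q r : R) :
  (0 < m)%N -> 1/2 < a -> a <= 3/4 -> b = 2 * a - 1 -> al = 1/2 + m%:R * a + b ->
  1 < Q -> Q^-1 <= r -> 0 < r -> r <= Q `^ (- (1/2)) ->
  Q `^ (1/2 - b) * r * (r + Q `^ (- a)) ^+ m <= 2 ^+ m * r `^ al.
Proof.
move=> m0 a1 a2 bE aE Q1 r1 r0 r2; have Q0 : 0 < Q by lra.
have Qn0 x : 0 <= Q `^ x := powR_ge0 _ _.
have m1 : 1 <= m%:R :> R by rewrite ler1n.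
have QD x y : Q `^ x * Q `^ y = Q `^ (x + y) by rewrite powRD// (gt_eqF Q0)/= implybT.
have [rQ|/ltW rQ] := leP (Q `^ (- a)) r.
- apply: (@le_trans _ _ (Q `^ (1/2 - b) * r * (2 * r) ^+ m)).
    apply: ler_wpM2l; first by rewrite mulr_ge0// ltW.
    by have := Qn0 (- a); move=> ?; apply: lerXn2r; rewrite ?nnegrE; lra.
  rewrite exprMn mulrCA ler_pM2l ?exprn_gt0//.
  have [t rt] := powR_surj _ _ _ Q1 r0; subst r.
  rewrite -powR_inv1 ?(ltW Q0)// in r1.
  rewrite !powR_le_mono// !lerN2 in r1 r2 rQ.
  rewrite powR_exprn !QD -powRrM powR_le_mono//.
  have h : 1/2 - b + 1 - a <= m%:R + 1 - al by rewrite aE; nra.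
  have : t * (1/2 - b + 1 - a) <= t * (m%:R + 1 - al) by rewrite ler_pM2l//; lra.
  nra.
- apply: (@le_trans _ _ (Q `^ (1/2 - b) * r * (2 * Q `^ (- a)) ^+ m)).
    apply: ler_wpM2l; first by rewrite mulr_ge0// ltW.
    by have := Qn0 (- a); move=> ?; apply: lerXn2r; rewrite ?nnegrE; lra.
  rewrite exprMn mulrCA ler_pM2l ?exprn_gt0//.
  have [t rt] := powR_surj _ _ _ Q1 r0; subst r.
  rewrite -powR_inv1 ?(ltW Q0)// in r1.
  rewrite !powR_le_mono// !lerN2 in r1 r2 rQ.
  rewrite powR_exprn !QD -powRrM powR_le_mono//.
  have al1 : 1 <= al by rewrite aE; nra.
  have : 0 <= (al - 1) * (1 - t) by rewrite mulr_ge0//; lra.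
  by rewrite aE => ?; lra.
Qed.

Lemma Rk_powR_unbounded (R : realType) (e y : R) : 0 < e -> exists k, y <= Rk R k `^ e.
Proof.
move=> e0.
have q1 : 1 < (2 : R) `^ e.
  have := powR_le_mono R 2 e 0 ltac:(rewrite ltr1n//); rewrite powRr0 => h.
  by rewrite ltNge h -ltNge.
(* Bernoulli's inequality for the powers of 2^e. *)
have [k hk] : exists k : nat, y <= 1 + k%:R * (2 `^ e - 1).
  exists (Num.truncn (y / (2 `^ e - 1))).+1.
  have := truncnS_gt (y / (2 `^ e - 1)).
  rewrite ltr_pdivrMr ?subr_gt0// => /ltW; lra.
exists k; apply: le_trans hk _.
rewrite /Rk -powR_mulrn// -powRrM (mulrC k%:R e) powRrM powR_mulrn ?powR_ge0//.
elim: k => [|k IH]; first by rewrite expr0 mul0r addr0.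
rewrite exprS -natr1.
have k0 : 0 <= k%:R :> R by [].
move: IH q1; set q := 2 `^ e; set p := q ^+ k => IH q1.
have : 0 <= k%:R * (q - 1) by rewrite mulr_ge0//; lra.
nra.
Qed.

(** The condition on a new scale depends on the earlier ones; a state that records them reduces the
    recursion to ordinary choice. *)
Lemma history_sequence (S : Type) (s0 : S) (next : S -> nat -> S) (P : S -> nat -> Prop) :
  (forall s, exists k, P s k) ->
  exists (k : nat -> nat) (s : nat -> S),
    s 0%N = s0 /\ forall j, s j.+1 = next (s j) (k j) /\ P (s j) (k j).
Proof.
move=> /choice[kap kapP].
pose s := fix s j := if j is i.+1 then next (s i) (kap (s i)) else s0.
by exists (fun j => kap (s j)), s.
Qed.

Lemma ler_pow_prod (R : realType) (m : nat) (x y u v D1 D2 : R) :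
  0 <= x -> 0 <= y -> 0 <= D1 -> 0 <= D2 -> x <= D1 * u -> y <= D2 * v ->
  x * y ^+ m <= D1 * D2 ^+ m * (u * v ^+ m).
Proof.
move=> x0 y0 D10 D20 xu yv.
have -> : D1 * D2 ^+ m * (u * v ^+ m) = D1 * u * (D2 * v) ^+ m.
  by rewrite exprMn; ring.
by apply: ler_pM => //; rewrite ?exprn_ge0// lerXn2r ?nnegrE// (le_trans y0).
Qed.

(* Mass of a ball of radius r between two consecutive scales 1/Q <= r < 1/rho. In the long
   direction the grid of the next scale Q' gives the sharper bound once r is below the slab
   length Q^(-1/2), hence the alternative. *)
Lemma slab_scale_estimate (R : realType) (m : nat) (a b al s c rho Q Q' H0 D1 D2 r : R) :
  (0 < m)%N -> 1/2 < a -> a <= 3/4 -> b = 2 * a - 1 -> al = 1/2 + m%:R * a + b ->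
  s < al -> 0 < c -> 0 < rho -> 1 < Q -> 0 <= H0 -> 0 <= D1 -> 0 <= D2 ->
  D1 * D2 ^+ m <= H0 * rho `^ (m.+1%:R - s) ->
  D1 * D2 ^+ m <= Q `^ (b * (al - s)) ->
  4 * Q' `^ (- b) <= r -> Q^-1 <= r -> r < rho^-1 ->
  let C := 10 ^+ m.+1 * H0 + 10 ^+ m.+1 + 16 / c * 8 ^+ m in
  let g D e := 2 * D * (r + 2 * e) in
  g D1 (2 * Q `^ (- b)) * g D2 (Q `^ (- a)) ^+ m <= C * r `^ s \/
  g (4 / c * Q `^ (1/2 - b) * D1) (2 * Q' `^ (- b)) * g D2 (Q `^ (- a)) ^+ m <= C * r `^ s.
Proof.
move=> m0 a1 a2 bE aE sal c0 rho0 Q1 H00 D10 D20 hH hQ rQ' rQ rrho C g.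
have Q0 : 0 < Q by lra.
have r0 : 0 < r by apply: lt_le_trans rQ; rewrite invr_gt0.
have Qn0 x : 0 <= Q `^ x := powR_ge0 _ _.
have rn0 x : 0 <= r `^ x := powR_ge0 _ _.
have m1 : 1 <= m%:R :> R by rewrite ler1n.
have T1 : 0 <= 10 ^+ m.+1 * H0 by rewrite mulr_ge0// exprn_ge0.
have T2 : 0 <= 10 ^+ m.+1 :> R by rewrite exprn_ge0.
have T3 : 0 <= 16 / c * 8 ^+ m by rewrite mulr_ge0 ?exprn_ge0// divr_ge0// ltW.
have g0 D e : 0 <= D -> 0 <= e -> 0 <= g D e.
  by move=> D0 e0; rewrite /g; apply: mulr_ge0; lra.
have gle D e u : 0 <= D -> 2 * (r + 2 * e) <= u -> g D e <= D * u.
  by move=> D0 eu; rewrite /g (mulrC 2 D) -mulrA ler_wpM2l.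
have h0 : 0 <= D1 * D2 ^+ m by rewrite mulr_ge0// exprn_ge0.
have Qab : Q `^ (- a) <= Q `^ (- b) by rewrite powR_le_mono//; lra.
have rD x y : r `^ x * r `^ y = r `^ (x + y) by rewrite powRD// (gt_eqF r0)/= implybT.
have one1 x : 1 `^ x = 1 :> R by rewrite powR1.
(* Coarse range: all sides are comparable to r, and r rho < 1 absorbs the density. *)
have [rb|/ltW rb] := leP (Q `^ (- b)) r.
  left; apply: (@le_trans _ _ (10 ^+ m.+1 * H0 * r `^ s)); last by rewrite ler_wpM2r// /C; lra.
  apply: (@le_trans _ _ (D1 * D2 ^+ m * (10 * r * (10 * r) ^+ m))).
    apply: ler_pow_prod => //; rewrite ?g0// ?mulr_ge0//.
      by apply: gle => //; lra.
    by apply: gle => //; have := Qn0 (- a); lra.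
  rewrite -exprS exprMn mulrCA -mulrA ler_wpM2l//.
  apply: (@le_trans _ _ (H0 * rho `^ (m.+1%:R - s) * r ^+ m.+1)).
    by rewrite ler_wpM2r// exprn_ge0// ltW.
  rewrite -mulrA ler_wpM2l// -powR_mulrn ?(ltW r0)//.
  rewrite -[X in r `^ X](subrK s) -rD mulrA -powRM ?(ltW rho0) ?(ltW r0)//.
  rewrite ler_piMl//.
  have ma : m%:R * a <= m%:R * 1 by rewrite ler_wpM2l//; lra.
  have al_n : al <= m.+1%:R by rewrite aE -(natr1 m); lra.
  rewrite -[leRHS](one1 (m.+1%:R - s)); apply: ge0_ler_powR; rewrite ?nnegrE//.
  - by lra.
  - by rewrite mulr_ge0// ltW.
  - by rewrite mulrC -ler_pdivlMr// div1r ltW.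
(* Here r <= Q^(-b), so the gap al - s in the exponent pays for the densities of earlier scales. *)
have hs : D1 * D2 ^+ m * r `^ al <= r `^ s.
  apply: (@le_trans _ _ (Q `^ (b * (al - s)) * r `^ al)); first by rewrite ler_wpM2r.
  rewrite -[X in r `^ X](subrK s) -rD mulrA powRrM -powRM ?(ltW r0)//.
  rewrite ler_piMl//.
  rewrite -[leRHS](one1 (al - s)); apply: ge0_ler_powR; rewrite ?nnegrE//.
  - by lra.
  - by rewrite mulr_ge0// ltW.
  - by rewrite powRN in rb; rewrite mulrC -ler_pdivlMr ?powR_gt0// div1r.
(* Middle range: one grid interval of mesh 2 Q^(-b) dominates the long direction. *)
have [rh|/ltW rh] := leP (Q `^ (- (1/2))) r.
  left; apply: (@le_trans _ _ (10 ^+ m.+1 * r `^ s)); last by rewrite ler_wpM2r// /C; lra.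
  apply: (@le_trans _ _ (D1 * D2 ^+ m * (10 * Q `^ (- b) * (10 * r) ^+ m))).
    have Qha : Q `^ (- a) <= Q `^ (- (1/2)) by rewrite powR_le_mono//; lra.
    apply: ler_pow_prod => //; rewrite ?g0// ?mulr_ge0//.
      by apply: gle => //; lra.
    by apply: gle => //; have := Qn0 (- a); lra.
  have -> : D1 * D2 ^+ m * (10 * Q `^ (- b) * (10 * r) ^+ m) =
     10 ^+ m.+1 * (D1 * D2 ^+ m * (Q `^ (- b) * r ^+ m)) by rewrite exprMn exprS; ring.
  rewrite ler_wpM2l//; apply: le_trans hs; rewrite ler_wpM2l//.
  exact: (long_scale_bound _ _ a).
(* Fine range: the next generation resolves the long direction down to 4 Q'^(-b) <= r, at the price
   of the density factor (4/c) Q^(1/2 - b). *)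
right; apply: (@le_trans _ _ (16 / c * 8 ^+ m * r `^ s)); last by rewrite ler_wpM2r// /C; lra.
have E0 : 0 <= 4 / c * Q `^ (1/2 - b) * D1 by rewrite !mulr_ge0// invr_ge0 ltW.
apply: (@le_trans _ _ (4 / c * Q `^ (1/2 - b) * D1 * D2 ^+ m *
    (4 * r * (4 * (r + Q `^ (- a))) ^+ m))).
  apply: ler_pow_prod => //; rewrite ?g0// ?mulr_ge0// ?powR_ge0//.
    by apply: gle => //; lra.
  by apply: gle => //; have := Qn0 (- a); lra.
have -> : 4 / c * Q `^ (1/2 - b) * D1 * D2 ^+ m * (4 * r * (4 * (r + Q `^ (- a))) ^+ m)
   = 16 / c * 4 ^+ m * (D1 * D2 ^+ m * (Q `^ (1/2 - b) * r * (r + Q `^ (- a)) ^+ m)).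
  by rewrite exprMn; field; rewrite gt_eqF.
have -> : 8 ^+ m = 4 ^+ m * 2 ^+ m :> R by rewrite -exprMn -natrM.
rewrite (mulrA (16 / c)) -[leRHS]mulrA; apply: ler_wpM2l.
  by rewrite mulr_ge0 ?exprn_ge0// divr_ge0// ltW.
apply: (@le_trans _ _ (D1 * D2 ^+ m * (2 ^+ m * r `^ al))).
  by apply: ler_wpM2l => //; exact: short_scale_bound.
by rewrite mulrCA; apply: ler_wpM2l => //; exact: exprn_ge0.
Qed.

(** * The Cantor set inside the set of divergence *)

Definition spacing (R : realType) (a b : R) (k : nat -> nat) (long : bool) (j : nat) : R :=
  if long then 2 * Rk R (k j) `^ (- b) else Rk R (k j) `^ (- a).

(** Generation 0 is [0, c0], which keeps the Cantor set in the cube; generation j + 1 has the sides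
    of the slabs of scale [k j]. *)
Definition width (R : realType) (c c0 : R) (k : nat -> nat) (long : bool) (j : nat) : R :=
  if j is i.+1 then
    if long then c * Rk R (k i) `^ (- (1/2)) else c / Rk R (k i)
  else c0.

Lemma Rk_ge1 (R : realType) k : 1 <= Rk R k.
Proof. by rewrite exprn_ege1// ler1n. Qed.

Theorem theorem5p3 (R : realType) (n : nat) (a b : R) :
  (2 <= n)%N -> 1/2 < a -> a <= 3/4 -> b = 2 * a - 1 ->
  exists cbar : R, 0 < cbar /\
  forall c : R, 0 < c -> c <= cbar ->
  forall c0 : R, 0 < c0 -> c0 <= 1 ->
  ((1/2 + (n%:R - 1) * a + b)%:E <=
     hausdorff_dim R n (Fset R n a b c `&` cube R n c0))%E.
Proof.
case: n => [//|m]; rewrite ltnS => m0 a1 a2 bE.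
(* With c <= 1 the slab sides do not exceed the mesh. *)
exists 1; split => // c c_gt0 c_le1 c0 c0_gt0 c0_le1.
apply: hausdorff_dim_ge => s s_gt0.
rewrite -(natr1 m) addrK; set al := (1/2 + m%:R * a + b) => s_lt.
have b_gt0 : 0 < b by lra.
(* Constant growth of the density product per generation: 4/c from the long direction, 2/c from each
   of the others. *)
pose M := 4 / c * (2 / c) ^+ m.
have M_gt0 : 0 < M by rewrite mulr_gt0 ?exprn_gt0// divr_gt0.
have M_ge1 : 1 <= M.
  have c2 : 1 <= 2 / c by rewrite ler_pdivlMr//; lra.
  have c4 : 1 <= 4 / c by rewrite ler_pdivlMr//; lra.
  by rewrite -[leLHS]mul1r ler_pM// exprn_ege1.
pose e := b * (al - s).
have e_gt0 : 0 < e by rewrite mulr_gt0// subr_gt0.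
(* The state is (previous R_k, product of the current densities); the next R_k is taken large
   compared with both. *)
pose next (st : R * R) k := (Rk R k, M * Rk R k `^ (m.+1%:R - al) * st.2).
pose ok (st : R * R) k :=
  12 * st.1 / c <= Rk R k `^ b /\ M * st.2 <= Rk R k `^ e.
have ok_ex st : exists k, ok st k.
  have me : 0 < Num.min b e by rewrite lt_min b_gt0.
  have [k] := Rk_powR_unbounded R _ (Num.max (12 * st.1 / c) (M * st.2)) me.
  rewrite ge_max => /andP[h1 h2]; exists k; split.
    by apply: le_trans h1 _; rewrite ler_powR ?Rk_ge1// ge_min lexx.
  by apply: le_trans h2 _; rewrite ler_powR ?Rk_ge1// ge_min lexx orbT.
(* The initial state holds the inverse side and the density of uniform mass on the cube
   [0, c0]^n. *)
have [k [st [st0 stS]]] := history_sequence _ (c0^-1, c0^-1 ^+ m.+1) next ok ok_ex.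
pose rho j := (st j).1; pose h j := (st j).2.
have c0V : 1 <= c0^-1 by rewrite invf_ge1.
have rhoS j : rho j.+1 = Rk R (k j) by rewrite /rho; have [-> _] := stS j.
have hS j : h j.+1 = M * Rk R (k j) `^ (m.+1%:R - al) * h j.
  by rewrite /h; have [-> _] := stS j.
have rho_ge1 j : 1 <= rho j by case: j => [|j]; rewrite ?rhoS ?Rk_ge1// /rho st0.
have Qb j : 12 * rho j / c <= Rk R (k j) `^ b by have [_ []] := stS j.
have Qe j : M * h j <= Rk R (k j) `^ e by have [_ []] := stS j.
have Q0 j : 0 < Rk R (k j) by have := Rk_ge1 R (k j); lra.
have rhoc j : rho j <= rho j / c by rewrite ler_pdivlMr// ler_piMr//; have := rho_ge1 j; lra.
have rho12 j : 12 * rho j <= Rk R (k j).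
  have : Rk R (k j) `^ b <= Rk R (k j) by rewrite ler1_powR ?Rk_ge1//; lra.
  by have := Qb j; have := rhoc j; lra.
have Qb' j : Rk R (k j) `^ (- b) <= c / 12 / rho j.
  have r0 : 0 < rho j by have := rho_ge1 j; lra.
  rewrite powRN -[leRHS]invrK lef_pV2 ?posrE ?powR_gt0 ?invr_gt0 ?divr_gt0//.
  apply: le_trans (Qb j); rewrite le_eqVlt; apply/orP; left; apply/eqP.
  by field; rewrite !gt_eqF.
have k_ge j : (j <= k j)%N.
  elim: j => // j IH; apply: leq_ltn_trans IH _.
  rewrite -(ltr_eXn2l (R := R) (x := 2)) ?ltr1n//.
  by have := rho12 j.+1; rewrite rhoS /Rk; have := Q0 j; rewrite /Rk; lra.
have Q1 j : 1 < Rk R (k j) by have := rho12 j; have := rho_ge1 j; lra.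
pose d (i : bool) := spacing R a b k i; pose l (i : bool) := width R c c0 k i.
have dl i j : 0 < l i j.+1 <= d i j.
  rewrite /l /d /spacing /=; case: i.
    rewrite mulr_gt0 ?powR_gt0//=; apply: ler_pM; rewrite ?powR_ge0 ?(ltW c_gt0)//; first by lra.
    by rewrite powR_le_mono//; lra.
  rewrite divr_gt0//= -powR_inv1 ?(ltW (Q0 j))// -[leRHS]mul1r.
  by apply: ler_pM; rewrite ?powR_ge0 ?(ltW c_gt0)// powR_le_mono//; lra.
(* The 12 in [ok] is 6 times the factor 2 of the long mesh; every interval of generation j has
   length at least c / [rho j]. *)
have ld i j : 6 * d i j <= l i j.
  have dQ : 6 * d i j <= 12 * Rk R (k j) `^ (- b).
    rewrite /d /spacing; case: i; first by lra.
    have : Rk R (k j) `^ (- a) <= Rk R (k j) `^ (- b) by rewrite powR_le_mono//; lra.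
    by have := powR_ge0 (Rk R (k j)) (- b); lra.
  have cl : c / rho j <= l i j.
    case: j {dQ} => [|j]; first by rewrite /rho st0 /= invrK ler_piMl// ltW.
    rewrite rhoS /l /=; case: i => //; rewrite ler_pM2l// -powR_inv1 ?(ltW (Q0 j))//.
    by rewrite powR_le_mono//; lra.
  by have := Qb' j; lra.
pose D i j := density R (d i) (l i) j.
have QD j x y : Rk R (k j) `^ (x + y) = Rk R (k j) `^ x * Rk R (k j) `^ y.
  by rewrite powRD// (gt_eqF (Q0 j))/= implybT.
have D_long j : D true j.+1 = 4 / c * Rk R (k j) `^ (1/2 - b) * D true j.
  rewrite /D /= /l /d /spacing /=; congr (_ * _).
  by rewrite QD (powRN _ (1/2)); field; rewrite !gt_eqF ?powR_gt0.
have D_short j : D false j.+1 = 2 / c * Rk R (k j) `^ (1 - a) * D false j.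
  rewrite /D /= /l /d /spacing /=; congr (_ * _).
  by rewrite QD powRr1 ?(ltW (Q0 j))//; field; rewrite !gt_eqF.
have hD j : h j = D true j * D false j ^+ m.
  elim: j => [|j IH]; first by rewrite /h st0 /= exprS.
  rewrite hS IH D_long D_short.
  have -> : m.+1%:R - al = (1/2 - b) + m%:R * (1 - a) by rewrite /al -(natr1 m); field.
  by rewrite QD -powR_exprn /M !exprMn; ring.
pose H0 := c0^-1 ^+ m.+1.
have H0_ge1 : 1 <= H0 by rewrite exprn_ege1.
have al_n : al <= m.+1%:R.
  have m1 : m%:R * a <= m%:R * 1 :> R by rewrite ler_wpM2l//; lra.
  by rewrite /al -(natr1 m); lra.
have hQ j : h j <= Rk R (k j) `^ e.
  apply: le_trans (Qe j); rewrite ler_peMl//.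
  by rewrite hD mulr_ge0 ?exprn_ge0// density_ge0.
(* Lowering al to s gains Q^(al - s), which absorbs M and the earlier densities because e <= al -
   s. *)
have hinv j : h j <= H0 * rho j `^ (m.+1%:R - s).
  case: j => [|j].
    rewrite /h /rho st0 /= -/H0 ler_peMr ?(le_trans _ H0_ge1)//.
    by rewrite -[leLHS](powRr0 c0^-1); apply: ler_powR => //; lra.
  rewrite hS rhoS mulrAC.
  have -> : m.+1%:R - s = (al - s) + (m.+1%:R - al) by lra.
  rewrite (QD _ (al - s)).
  rewrite mulrA ler_wpM2r ?powR_ge0//.
  apply: le_trans (Qe j) _; apply: (@le_trans _ _ (Rk R (k j) `^ (al - s))).
    rewrite powR_le_mono// /e ler_piMl//; lra.
  by rewrite ler_peMl ?powR_ge0.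
exists (fun t i => cantor_point R (d (val i == 0%N)) (l (val i == 0%N)) (t i)).
exists (10 ^+ m.+1 * H0 + 10 ^+ m.+1 + 16 / c * 8 ^+ m), c0; split => // [t t01|r /andP[r0 rc0]].
  split; last first.
    move=> i; have /andP[ti _] := t01 i.
    by have := cantor_point_itv _ _ _ (dl (val i == 0%N)) (ld (val i == 0%N)) _ ti; rewrite /l /=.
  move=> N _; exists (k N); first exact: k_ge.
  have /choice[p pP] (i : 'I_m.+1) : exists p : int,
     `|cantor_point R (d (val i == 0%N)) (l (val i == 0%N)) (t i) -
       p%:~R * d (val i == 0%N) N| <= l (val i == 0%N) N.+1 / 2.
    by apply: cantor_point_near; have /andP[] := t01 i.
  exists p, 1%N; split => //.
  - by split => i _; [rewrite coprimezE coprimen1|split].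
  - by rewrite /Qk bE (_ : 2 * a - _ - 1 = 0) ?mulr0 ?powRr0//; ring.
  (* For b = 2a - 1, n - (n - 1) a + n b = (n + 1) a. *)
  have DE : Dk R m.+1 a b (k N) = Rk R (k N) `^ a.
    rewrite /Dk; congr (_ `^ _); rewrite bE -(natr1 m); field.
    by rewrite natr1 natr1 pnatr_eq0.
  move=> i; have := pP i; rewrite /slab_center DE /d /l /spacing /=.
  have -> : (if val i == 0%N then 2 * (p i)%:~R * Rk R (k N) / (1 * Rk R (k N) `^ a ^+ 2)
       else (p i)%:~R / (Rk R (k N) `^ a * 1)) =
      (p i)%:~R * (if val i == 0%N then 2 * Rk R (k N) `^ (- b) else Rk R (k N) `^ (- a)).
    case: ifP => _; last by rewrite mulr1 powRN.
    have -> : - b = 1 + - (2 * a) by rewrite bE; ring.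
    rewrite powRD; last by rewrite (gt_eqF (Q0 N))/= implybT.
    rewrite powRr1 ?(ltW (Q0 N))// powRN powR_exprn; field.
    by rewrite gt_eqF// powR_gt0.
  by [].
(* Since 1 / [rho 0] = c0 > r, descending from a large index finds consecutive scales around r. *)
have rho_inv j : (rho j.+1)^-1 <= r -> exists j', (rho j'.+1)^-1 <= r /\ r < (rho j')^-1.
  elim: j => [|j IH] hj; first by exists 0%N; split => //; rewrite /rho st0 /= invrK.
  by have [/IH//|] := leP (rho j.+1)^-1 r; exists j.+1.
have [j [rj rj']] : exists j', (rho j'.+1)^-1 <= r /\ r < (rho j')^-1.
  apply: (rho_inv (Num.truncn r^-1)).
  rewrite -[leRHS]invrK lef_pV2 ?posrE ?invr_gt0//; last by have := rho_ge1 (Num.truncn r^-1).+1; lra.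
  apply: le_trans (ltW (truncnS_gt r^-1)) _.
  elim: (Num.truncn _).+1 => [|i IH]; first by have := rho_ge1 0%N; lra.
  by have := rho12 i; have := rho_ge1 i; rewrite rhoS -natr1; lra.
pose g D e : R := 2 * D * (r + 2 * e).
(* The long direction may use its own generation, j or j + 1, following the alternative in
   [slab_scale_estimate]. *)
have [j1 j1P] : exists j1, g (D true j1) (d true j1) * g (D false j) (d false j) ^+ m <=
    (10 ^+ m.+1 * H0 + 10 ^+ m.+1 + 16 / c * 8 ^+ m) * r `^ s.
  have rho_gt0 i : 0 < rho i by have := rho_ge1 i; lra.
  have H0_ge0 : 0 <= H0 by lra.
  have h1 : D true j * D false j ^+ m <= H0 * rho j `^ (m.+1%:R - s) by rewrite -hD.
  have h2 : D true j * D false j ^+ m <= Rk R (k j) `^ e by rewrite -hD.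
  have D0 i : 0 <= D i j by exact: density_ge0.
  have r4 : 4 * Rk R (k j.+1) `^ (- b) <= r.
    have v0 : 0 <= (rho j.+1)^-1 by rewrite invr_ge0 ltW.
    by have := ler_piMl v0 c_le1; have := Qb' j.+1; lra.
  have rQ : (Rk R (k j))^-1 <= r by rewrite -rhoS.
  have [|] := slab_scale_estimate _ _ _ _ _ _ _ _ _ _ _ _ _ _
    m0 a1 a2 bE erefl s_lt c_gt0 (rho_gt0 j) (Q1 j) H0_ge0 (D0 true) (D0 false) h1 h2 r4 rQ rj'.
    by exists j.
  by rewrite -D_long; exists j.+1.
exists (fun i => if val i == 0%N then g (D true j1) (d true j1) else g (D false j) (d false j)).
have g_ge0 i j2 : 0 <= g (D i j2) (d i j2).
  have D0 : 0 <= D i j2 by exact: density_ge0.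
  have d0 := spacing_gt0 _ _ _ (dl i) j2.
  by rewrite /g mulr_ge0 ?mulr_ge0//; lra.
split.
- by move=> i; case: ifP.
- by rewrite big_ord_recl /= prodr_const card_ord.
- move=> t t' t01 t'01 ft i.
  have g_dist j2 : `|t i - t' i| <= g (D (val i == 0%N) j2) (d (val i == 0%N) j2).
    apply: le_trans (cantor_point_dist _ _ _ (dl (val i == 0%N)) (ld (val i == 0%N)) j2 _ _
      (t01 i) (t'01 i)) _.
    apply: ler_wpM2l; first by rewrite mulr_ge0//; exact: density_ge0.
    by rewrite lerD2r; exact: ft.
  by case: ifP (g_dist) => _ {}g_dist.
Qed.
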